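(* Let $\mathcal{M},\lambda,c_3\in\mathbb{R}$ and set $$f(r)=(1+c_3r)^2-\frac{2\mathcal{M}}{r}(1+c_3r)^3-\frac{\lambda}{3}r^2 .$$ On a region where $r>0$, $f(r)>0$ and $1+c_3r>0$, consider the 4-dimensional metric $$g=-f\,dt^2+f^{-1}dr^2+r^2(d\theta^2+\sin^2\theta\,d\varphi^2).$$ Then $\big(M,g_{ab},u,Y,\xi,\lambda\big)$ with $$u=-\ln(1+c_3r),\qquad Y=r\,dt\wedge dr,\qquad \xi=\partial_t,$$ is a CKY--RS structure, and $Y$ is closed. The conformal representative $\tilde g=e^{2u}g$ is the Schwarzschild--de Sitter metric $-\tilde f\,dt^2+\tilde f^{-1}d\tilde r^2+\tilde r^2(d\theta^2+\sin^2\theta\,d\varphi^2)$ with $\tilde f=1-\frac{2\mathcal{M}}{\tilde r}-\frac{\lambda}{3}\tilde r^2$ and $\tilde r=e^{u}r$.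
   Context: Conformal Killing--Yano (CKY) 2-form on an $n$-dimensional pseudo-Riemannian manifold: a smooth 2-form $Y_{ab}$ with $\nabla_cY_{ab}=g_{ca}\xi_b-g_{cb}\xi_a+z_{abc}$, where $z_{abc}$ is totally antisymmetric and $\xi_a=\frac{1}{n-1}\nabla^bY_{ba}$; $\xi^a=\xi^a[Y]$ is its associated vector field. It is closed if $dY=0$. CKY--RS structure $(M,g_{ab},u,Y_{ab},\xi^a[Y],\lambda)$: $u\in C^\infty(M)$, $\lambda\in\mathbb{R}$, $Y$ is a CKY 2-form of $g$, $\xi=\xi[Y]$, and $\tilde g_{ab}=e^{2u}g_{ab}$ satisfies $\tilde R_{ab}+\frac12\mathcal{L}_{\xi}\tilde g_{ab}=\lambda\tilde g_{ab}$, $\tilde R_{ab}$ being the Ricci tensor of $\tilde g$. *)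

(* Defs.v *)
From HB Require Import structures.
From mathcomp Require Import all_boot all_order all_algebra.
From mathcomp Require Import all_classical reals topology normedtype sequences derive exp trigo.

Set Implicit Arguments.
Unset Strict Implicit.
Unset Printing Implicit Defensive.

Import Order.TTheory GRing.Theory Num.Theory.
Import numFieldNormedType.Exports.

Local Open Scope classical_set_scope.
Local Open Scope ring_scope.

(* Tensor calculus in a coordinate domain: a manifold is an open set U of R^n,
   points are row vectors x with coordinates x^i = x 0 i, and tensor fields are
   given by their components in the coordinate frame.  Fields are total
   functions on R^n; only their values on U matter, all statements being
   restricted to points of the open set U. *)
Section TensorCalculus.
Variables (R : realType) (n : nat).

Definition scalar_field := 'rV[R]_n -> R.
Definition vector_field := 'rV[R]_n -> 'rV[R]_n.   (* X^a = X x 0 a *)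
Definition tensor2_field := 'rV[R]_n -> 'M[R]_n.   (* T_ab = T x a b *)

Definition partial (i : 'I_n) (f : scalar_field) : scalar_field :=
  fun x => 'D_(delta_mx 0 i) f x.

Fixpoint Ck_on (k : nat) (U : set 'rV[R]_n) (f : scalar_field) : Prop :=
  (forall x, U x -> {for x, continuous f}) /\
  if k is k'.+1 then
    forall i, (forall x, U x -> derivable f x (delta_mx 0 i)) /\
              Ck_on k' U (partial i f)
  else True.

Definition smooth_on (U : set 'rV[R]_n) (f : scalar_field) : Prop :=
  forall k, Ck_on k U f.

Definition smooth_tensor2_on (U : set 'rV[R]_n) (T : tensor2_field) : Prop :=
  forall a b, smooth_on U (fun x => T x a b).

Record pseudo_riemannian_metric (U : set 'rV[R]_n) (g : tensor2_field) : Prop :=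
  PseudoRiemannianMetric {
    metric_smooth : smooth_tensor2_on U g;
    metric_sym : forall x, U x -> forall a b, g x a b = g x b a;
    metric_nondegenerate : forall x, U x -> g x \in unitmx }.

(* christoffel g a b c = Gamma^a_{bc} *)
Definition christoffel (g : tensor2_field) (a b c : 'I_n) : scalar_field :=
  fun x => 2^-1 * \sum_(d < n) invmx (g x) a d *
    (partial b (fun y => g y d c) x + partial c (fun y => g y d b) x
     - partial d (fun y => g y b c) x).

(* riemann g a b c d = R^a_{bcd}, with the sign convention
   (nabla_c nabla_d - nabla_d nabla_c) X^a = R^a_{bcd} X^b *)
Definition riemann (g : tensor2_field) (a b c d : 'I_n) : scalar_field :=
  fun x => partial c (christoffel g a d b) x - partial d (christoffel g a c b) x
    + \sum_(e < n) (christoffel g a c e x * christoffel g e d b x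
                    - christoffel g a d e x * christoffel g e c b x).

(* R_ab = R^c_{acb}; with this convention round spheres have positive Ricci
   tensor *)
Definition ricci (g : tensor2_field) : tensor2_field :=
  fun x => \matrix_(a, b) \sum_(c < n) riemann g c a c b x.

(* nabla2 g T c a b = nabla_c T_ab *)
Definition nabla2 (g : tensor2_field) (T : tensor2_field) (c a b : 'I_n) :
    scalar_field :=
  fun x => partial c (fun y => T y a b) x
    - \sum_(d < n) christoffel g d c a x * T x d b
    - \sum_(d < n) christoffel g d c b x * T x a d.

Definition lie_derivative2 (X : vector_field) (T : tensor2_field) :
    tensor2_field :=
  fun x => \matrix_(a, b) \sum_(c < n)
    (X x 0 c * partial c (fun y => T y a b) x
     + T x c b * partial a (fun y => X y 0 c) x
     + T x a c * partial b (fun y => X y 0 c) x).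

Definition conformal_metric (u : scalar_field) (g : tensor2_field) :
    tensor2_field :=
  fun x => expR (2 * u x) *: g x.

Definition smooth_2form_on (U : set 'rV[R]_n) (Y : tensor2_field) : Prop :=
  smooth_tensor2_on U Y /\ forall x, U x -> forall a b, Y x a b = - Y x b a.

(* (dY)_abc *)
Definition ext_derivative2 (Y : tensor2_field) (a b c : 'I_n) : scalar_field :=
  fun x => partial a (fun y => Y y b c) x + partial b (fun y => Y y c a) x
           + partial c (fun y => Y y a b) x.

Definition closed_2form_on (U : set 'rV[R]_n) (Y : tensor2_field) : Prop :=
  forall x, U x -> forall a b c, ext_derivative2 Y a b c x = 0.

(* xi_a = (n-1)^-1 nabla^b Y_ba *)
Definition assoc_covector (g Y : tensor2_field) (a : 'I_n) : scalar_field :=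
  fun x => (n%:R - 1)^-1 *
    \sum_(b < n) \sum_(c < n) invmx (g x) b c * nabla2 g Y c b a x.

(* xi^a = g^ab xi_b *)
Definition assoc_vector (g Y : tensor2_field) : vector_field :=
  fun x => \row_a \sum_(b < n) invmx (g x) a b * assoc_covector g Y b x.

Definition totally_antisym (z : 'I_n -> 'I_n -> 'I_n -> R) : Prop :=
  forall a b c, z a b c = - z b a c /\ z a b c = - z a c b.

Definition cky_2form (U : set 'rV[R]_n) (g Y : tensor2_field) : Prop :=
  smooth_2form_on U Y /\
  exists z : 'rV[R]_n -> 'I_n -> 'I_n -> 'I_n -> R,
    forall x, U x -> totally_antisym (z x) /\
      forall a b c, nabla2 g Y c a b x =
        g x c a * assoc_covector g Y b x - g x c b * assoc_covector g Y a x
        + z x a b c.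

Record cky_rs_structure (U : set 'rV[R]_n) (g : tensor2_field)
    (u : scalar_field) (Y : tensor2_field) (xi : vector_field) (lam : R) :
    Prop := CkyRsStructure {
  ckyrs_open : open U;
  ckyrs_metric : pseudo_riemannian_metric U g;
  ckyrs_u_smooth : smooth_on U u;
  ckyrs_cky : cky_2form U g Y;
  ckyrs_xi : forall x, U x -> xi x = assoc_vector g Y x;
  ckyrs_soliton : forall x, U x ->
    ricci (conformal_metric u g) x
    + 2^-1 *: lie_derivative2 xi (conformal_metric u g) x
    = lam *: conformal_metric u g x }.

Definition smooth_map_on (U : set 'rV[R]_n) (Phi : vector_field) : Prop :=
  forall a, smooth_on U (fun x => Phi x 0 a).

Definition diffeomorphism (U V : set 'rV[R]_n) (Phi : vector_field) : Prop :=
  [/\ open U, open V, smooth_map_on U Phi &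
    exists Psi : vector_field, [/\ smooth_map_on V Psi,
      forall x, U x -> V (Phi x) /\ Psi (Phi x) = x &
      forall y, V y -> U (Psi y) /\ Phi (Psi y) = y]].

(* (Phi^* h)_ab (x) = d_a Phi^c d_b Phi^d h_cd (Phi x) *)
Definition pullback2 (Phi : vector_field) (h : tensor2_field) : tensor2_field :=
  fun x => \matrix_(a, b) \sum_(c < n) \sum_(d < n)
    partial a (fun y => Phi y 0 c) x * partial b (fun y => Phi y 0 d) x
    * h (Phi x) c d.

(* components of dx^i (x) dx^i, of dx^i /\ dx^j (with
   dx^i /\ dx^j = dx^i (x) dx^j - dx^j (x) dx^i), and of d/dx^i *)
Definition dsq (i : 'I_n) : 'M[R]_n := delta_mx i i.
Definition dwedge (i j : 'I_n) : 'M[R]_n := delta_mx i j - delta_mx j i.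
Definition coord_vector (i : 'I_n) : vector_field := fun=> delta_mx 0 i.

End TensorCalculus.

(* the coordinates (t, r, theta, phi) *)
Definition i_t : 'I_4 := @Ordinal 4 0 isT.
Definition i_r : 'I_4 := @Ordinal 4 1 isT.
Definition i_th : 'I_4 := @Ordinal 4 2 isT.
Definition i_ph : 'I_4 := @Ordinal 4 3 isT.

Section StaticMetrics.
Variable R : realType.

(* - F(r) dt^2 + F(r)^-1 dr^2 + r^2 (dtheta^2 + sin^2 theta dphi^2) *)
Definition static_metric (F : R -> R) : tensor2_field R 4 := fun x =>
  let r := x 0 i_r in let theta := x 0 i_th in
  - F r *: dsq R i_t + (F r)^-1 *: dsq R i_r
  + r ^+ 2 *: (dsq R i_th + sin theta ^+ 2 *: dsq R i_ph).

Definition f_profile (M lam c3 : R) (r : R) : R :=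
  (1 + c3 * r) ^+ 2 - 2 * M / r * (1 + c3 * r) ^+ 3 - lam / 3 * r ^+ 2.

Definition sds_profile (M lam : R) (r : R) : R :=
  1 - 2 * M / r - lam / 3 * r ^+ 2.

Definition u_field (c3 : R) : scalar_field R 4 :=
  fun x => - ln (1 + c3 * x 0 i_r).

Definition Y_field : tensor2_field R 4 :=
  fun x => x 0 i_r *: dwedge R i_t i_r.

(* (t, r, theta, phi) |-> (t, e^u r, theta, phi) *)
Definition rescale_r (u : scalar_field R 4) : vector_field R 4 := fun x =>
  \row_i (if i == i_r then expR (u x) * x 0 i_r else x 0 i).

End StaticMetrics.

(* Main.v *)
Require Import Defs.
From HB Require Import structures.
From mathcomp Require Import all_boot all_order all_algebra.
From mathcomp Require Import all_classical reals topology normedtype sequences derive exp trigo.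
From mathcomp Require Import realfun ring.

Set Implicit Arguments.
Unset Strict Implicit.
Unset Printing Implicit Defensive.

Import Order.TTheory GRing.Theory Num.Theory.
Import numFieldNormedType.Exports.
Local Open Scope classical_set_scope.
Local Open Scope ring_scope.

(* Write h = 1 + c3 r and let P(r) = sds(r / h) be the Schwarzschild-de Sitter
   profile at the rescaled radius.  Then f = h^2 P and e^u = 1 / h, so that
   e^(2u) g = - P dt^2 + dr^2 / (P h^4) + (r / h)^2 dOmega^2; as (r / h)' = 1 / h^2,
   this is the Schwarzschild-de Sitter metric pulled back along r |-> r / h.
   Both g and e^(2u) g have the form a(r) dt^2 + b(r) dr^2 + c(r) dOmega^2, whose
   Christoffel symbols and Ricci tensor are computed once for arbitrary a, b, c.
   The first gives nabla_c Y_ab = g_ca xi_b - g_cb xi_a with xi_a = - f dt, i.e.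
   xi^a = d/dt and z = 0; the second gives Ric = lam e^(2u) g, and the Lie
   derivative term vanishes because nothing depends on t. *)

(** * Smooth functions on open subsets of R^n *)

(** A directional derivative only sees the restriction to a line. This is what reduces every
    [partial] below to a derivative in one real variable. *)
Lemma derive_along_line {R : realType} {V W : normedModType R} (f : V -> W) x v :
  'D_v f x = 'D_1 (fun h : R => f (h *: v + x)) 0.
Proof.
rewrite /derive; set g1 := fun h => h^-1 *: _; set g2 := fun h => h^-1 *: _.
suff -> : g1 = g2 by [].
by rewrite funeqE /g1 /g2 => h /=; rewrite addr0 scale0r add0r [_%:A]mulr1.
Qed.

Section RealDerivatives.
Context {R : realType}.
Implicit Types (f g : R -> R) (c x a b : R).

(** This rule and the following ones are phrased for explicit lambda terms and ordinary products.
    Derivatives are then assembled as proof terms, and [is_derive_eq] leaves only an identity for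
    [ring] or [field]. *)
Lemma is_derive_mul f g x a b :
  is_derive x 1 f a -> is_derive x 1 g b ->
  is_derive x 1 (fun y => f y * g y) (f x * b + g x * a).
Proof. exact: is_deriveM. Qed.

Lemma is_derive_add f g x a b :
  is_derive x 1 f a -> is_derive x 1 g b ->
  is_derive x 1 (fun y => f y + g y) (a + b).
Proof. exact: is_deriveD. Qed.

Lemma is_derive_opp f x a :
  is_derive x 1 f a -> is_derive x 1 (fun y => - f y) (- a).
Proof. exact: is_deriveN. Qed.

Lemma is_derive_inv f x a : is_derive x 1 f a -> f x != 0 ->
  is_derive x 1 (fun y => (f y)^-1) (- a / f x ^+ 2).
Proof.
move=> df f0; have df' := is_deriveV f0 df.
by apply: is_derive_eq; rewrite -[_ *: _]/(_ * _) mulrC mulrN mulNr.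
Qed.

Lemma is_derive_pow f m x a :
  is_derive x 1 f a ->
  is_derive x 1 (fun y => f y ^+ m) (m%:R * f x ^+ m.-1 * a).
Proof. by move=> df; rewrite -exprfctE; apply: is_deriveX. Qed.

Lemma is_derive_const c x : is_derive x 1 (fun=> c) 0.
Proof. exact: is_derive_cst. Qed.

Lemma is_derive_var x : is_derive x 1 (fun y : R => y) 1.
Proof. exact: is_derive_id. Qed.

Lemma is_derive_invX c m x : x != 0 ->
  is_derive x 1 (fun y => c * y ^- m) (- (c * m%:R) * x ^- m.+1).
Proof.
move=> x0; have d1 := is_derive_pow m (is_derive_var x).
have d2 := is_derive_inv d1 (expf_neq0 m x0).
refine (is_derive_eq (is_derive_mul (is_derive_const c x) d2) _).
case: m {d1 d2} => [|m]; first by rewrite !(mulr0, mul0r, oppr0, addr0).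
have xm := expf_neq0 m x0.
by rewrite /= !exprS; field; rewrite xm x0.
Qed.

End RealDerivatives.

Section SmoothFunctions.
Context {R : realType} {n : nat}.
Implicit Types (U : set 'rV[R]_n) (f g : scalar_field R n) (i : 'I_n).

Lemma partial_near i f g x :
  (\near x, f x = g x) -> partial i f x = partial i g x.
Proof. exact: near_eq_derive. Qed.

Lemma open_near U x (P : set 'rV[R]_n) : open U -> U x ->
  (forall y, U y -> P y) -> \forall y \near x, P y.
Proof. by move=> Uo Ux UP; apply: filterS (open_nbhs_nbhs (conj Uo Ux)). Qed.

Lemma partial_eq_on i U f g x : open U -> U x ->
  (forall y, U y -> f y = g y) -> partial i f x = partial i g x.
Proof.
move=> Uo Ux fg; apply: partial_near.
exact: open_near Ux fg.
Qed.

(** Restricting [f] to the line through [x] along [v] turns this into the one-variable chain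
    rule. *)
Lemma is_derive_comp1 (phi : R -> R) f x v a b :
  is_derive (f x) 1 phi a -> is_derive x v f b ->
  is_derive x v (phi \o f) (a * b).
Proof.
move=> Hphi [df <-].
pose l (h : R) := f (h *: v + x).
have l0 : l 0 = f x by rewrite /l scale0r add0r.
have dl : is_derive (0 : R) 1 l ('D_v f x).
  by apply: DeriveDef; [exact: (derivable1P _ _ _).1|rewrite [RHS]derive_along_line].
have [dc1 dc2] : is_derive (0 : R) 1 (phi \o l) (a * 'D_v f x).
  by apply: is_derive1_comp; rewrite l0.
by apply: DeriveDef; [exact: (derivable1P _ _ _).2|rewrite derive_along_line].
Qed.

Lemma Ck_on_weaken k U f : Ck_on k.+1 U f -> Ck_on k U f.
Proof.
elim: k f => [|k IH] f; first by case=> cf _; split.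
case=> cf H; split=> // i; have [d Hd] := H i.
by split=> //; exact: IH.
Qed.

Lemma continuous_eq_on U f g x : open U -> U x ->
  (forall y, U y -> f y = g y) ->
  {for x, continuous f} -> {for x, continuous g}.
Proof.
move=> Uo Ux fg cf; rewrite /prop_for /continuous_at -fg//.
have E := near_eq_cvg (F := nbhs x) (open_near Uo Ux fg).
exact: cvg_trans (E _) cf.
Qed.

(** On an open set, agreement on [U] is agreement near each point of [U], so continuity,
    derivability and partial derivatives all transfer. Fields may thus be replaced by formulas valid
    only on [U]. *)
Lemma Ck_on_eq k U f g : open U -> (forall x, U x -> f x = g x) ->
  Ck_on k U f -> Ck_on k U g.
Proof.
move=> Uo; elim: k f g => [|k IH] f g fg [cf H].
  by split=> // x Ux; apply: continuous_eq_on fg (cf x Ux).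
have [c0 _] : Ck_on 0 U g.
  by split=> // x Ux; apply: continuous_eq_on fg (cf x Ux).
split=> // i; have [d Hd] := H i; split.
  move=> x Ux; exact: near_eq_derivable (open_near Uo Ux fg) (d x Ux).
apply: IH Hd => x Ux; exact: (partial_eq_on i Uo Ux fg).
Qed.

Lemma smooth_on_eq U f g : open U -> (forall x, U x -> f x = g x) ->
  smooth_on U f -> smooth_on U g.
Proof. by move=> Uo fg sf k; exact: Ck_on_eq (sf k). Qed.

Lemma smooth_on_cst U (c : R) : smooth_on U (fun=> c).
Proof.
move=> k; elim: k c => [|k IH] c; split=> //; try by move=> x _; exact: cst_continuous.
move=> i; split=> [x _|]; first exact: derivable_cst.
rewrite (_ : partial i _ = fun=> 0); first exact: IH.
by apply/funext => x; exact: derive_cst.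
Qed.

Lemma is_derive_coord i j (x : 'rV[R]_n) :
  is_derive x (delta_mx 0 i) (fun y : 'rV[R]_n => y 0 j) (i == j)%:R.
Proof.
have H : (fun h : R => h^-1 *: ((h *: (delta_mx 0 i : 'rV[R]_n) + x) 0 j - x 0 j))
    @ 0^' --> ((i == j)%:R : R).
  apply: cvg_near_cst; near=> h.
  have h0 : h != 0 by near: h; exact: nbhs_dnbhs_neq.
  rewrite !mxE eqxx/= addrK -[_ *: _]/(_ * _) mulrA mulVf// mul1r.
  by rewrite [j == i]eq_sym.
apply: DeriveDef; first by apply/cvg_ex; exists (i == j)%:R.
by apply: cvg_lim H.
Unshelve. all: by end_near. Qed.

Lemma partial_coord i j x :
  partial i (fun y : 'rV[R]_n => y 0 j) x = (i == j)%:R.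
Proof. exact: (@derive_val _ _ _ _ _ _ _ (is_derive_coord i j x)). Qed.

Lemma smooth_on_coord U j : smooth_on U (fun y => y 0 j).
Proof.
case=> [|k]; split=> //; try by move=> x _; exact: coord_continuous.
move=> i; split=> [x _|]; first exact: (ex_derive (is_derive := is_derive_coord i j x)).
rewrite (_ : partial i _ = fun=> (i == j)%:R); first exact: smooth_on_cst.
by apply/funext => x; exact: partial_coord.
Qed.

Lemma Ck_onD k U f g : open U -> Ck_on k U f -> Ck_on k U g ->
  Ck_on k U (fun x => f x + g x).
Proof.
move=> Uo; elim: k f g => [|k IH] f g [cf df] [cg dg]; split=> //;
  try by move=> x Ux; exact: (continuousD (cf x Ux) (cg x Ux)).
move=> i; have [d1 H1] := df i; have [d2 H2] := dg i.
split=> [x Ux|]; first by apply: derivableD; auto.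
apply: Ck_on_eq (IH _ _ H1 H2) => // x Ux.
by rewrite /partial; apply/esym/deriveD; auto.
Qed.

Lemma Ck_onM k U f g : open U -> Ck_on k U f -> Ck_on k U g ->
  Ck_on k U (fun x => f x * g x).
Proof.
move=> Uo; elim: k f g => [|k IH] f g Hf Hg;
  have [cf df] := Hf; have [cg dg] := Hg; split=> //;
  try by move=> x Ux; exact: (continuousM (cf x Ux) (cg x Ux)).
move=> i; have [d1 H1] := df i; have [d2 H2] := dg i.
split=> [x Ux|]; first by apply: derivableM; auto.
(* In the Leibniz rule each product keeps one undifferentiated factor, whose regularity is lowered
   by one to match the induction hypothesis. *)
apply: Ck_on_eq (Ck_onD Uo (IH _ _ (Ck_on_weaken Hf) H2)
  (IH _ _ (Ck_on_weaken Hg) H1)) => // x Ux.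
by rewrite /partial; apply/esym/deriveM; auto.
Qed.

Lemma smooth_onD U f g : open U -> smooth_on U f -> smooth_on U g ->
  smooth_on U (fun x => f x + g x).
Proof. by move=> Uo sf sg k; exact: Ck_onD. Qed.

Lemma smooth_onM U f g : open U -> smooth_on U f -> smooth_on U g ->
  smooth_on U (fun x => f x * g x).
Proof. by move=> Uo sf sg k; exact: Ck_onM. Qed.

Lemma smooth_onN U f : open U -> smooth_on U f -> smooth_on U (fun x => - f x).
Proof.
move=> Uo sf.
apply: smooth_on_eq (smooth_onM Uo (smooth_on_cst U (-1)) sf) => // x _.
by rewrite mulN1r.
Qed.

Lemma smooth_onX U f m : open U -> smooth_on U f ->
  smooth_on U (fun x => f x ^+ m).
Proof.
move=> Uo sf; elim: m => [|m IH]; first exact: smooth_on_cst.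
apply: smooth_on_eq (smooth_onM Uo sf IH) => // x _.
by rewrite exprS.
Qed.

(* A class [C] of functions closed under differentiation on [D] stands in for
   the one-variable smooth functions on [D]. *)
Lemma smooth_on_comp (C : set (R -> R)) (D : set R) U f phi : open U ->
  (forall psi, C psi -> exists2 psi', C psi' &
     forall y, D y -> is_derive y 1 psi (psi' y)) ->
  (forall x, U x -> D (f x)) -> C phi -> smooth_on U f ->
  smooth_on U (phi \o f).
Proof.
move=> Uo HC UD Cphi sf k.
have cont psi : C psi -> forall x, U x -> {for x, continuous (psi \o f)}.
  move=> Cpsi x Ux; have [psi' _ dpsi] := HC _ Cpsi.
  have [cf _] := sf 0%N; apply: continuous_comp; first exact: cf.
  apply/differentiable_continuous/derivable1_diffP.
  by have [] := dpsi _ (UD _ Ux).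
elim: k phi Cphi => [|k IH] phi Cphi; split=> //; try exact: cont.
move=> i; have [psi' C' dpsi] := HC _ Cphi.
have [_ /(_ i)[d1 _]] := sf 1%N.
have D1 x : U x -> is_derive x (delta_mx 0 i) (phi \o f) (psi' (f x) * partial i f x).
  move=> Ux; apply: is_derive_comp1; first exact/dpsi/UD.
  exact/derivableP/d1.
split=> [x Ux|]; first by have [] := D1 x Ux.
have [_ /(_ i)[_ H2]] := sf k.+1.
apply: Ck_on_eq (Ck_onM Uo (IH _ C') H2) => // x Ux.
by have [_ /esym] := D1 x Ux.
Qed.

(** Contains the inverse function and, unlike that function alone, is stable under differentiation
    away from 0. *)
Let inv_powers := [set phi : R -> R | exists c m, phi = fun y : R => c * y ^- m].

Let inv_powers_derive psi : inv_powers psi -> exists2 psi', inv_powers psi' &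
  forall y : R, y != 0 -> is_derive y 1 psi (psi' y).
Proof.
move=> [c [m ->]]; exists (fun y : R => - (c * m%:R) * y ^- m.+1).
  by exists (- (c * m%:R)), m.+1.
by move=> y y0; exact: is_derive_invX.
Qed.

Lemma smooth_onV U f : open U -> (forall x, U x -> f x != 0) ->
  smooth_on U f -> smooth_on U (fun x => (f x)^-1).
Proof.
move=> Uo f0 sf.
have H : smooth_on U ((fun y : R => 1 * y ^- 1) \o f).
  apply: (smooth_on_comp Uo inv_powers_derive) => //.
  by exists 1, 1%N.
by apply: smooth_on_eq H => // x _ /=; rewrite mul1r expr1.
Qed.

Lemma smooth_on_ln U f : open U -> (forall x, U x -> 0 < f x) ->
  smooth_on U f -> smooth_on U (fun x => ln (f x)).
Proof.
move=> Uo f0 sf.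
(* The derivative of [ln] is an inverse power, so adding [ln] to that class keeps it closed under
   differentiation on the positive reals. *)
apply: (@smooth_on_comp (inv_powers `|` [set @ln R]) [set y | 0 < y]) => //;
  last by right.
move=> psi [/inv_powers_derive[psi' C' H]|->].
  by exists psi'; [left|move=> y /= y0; apply: H; rewrite gt_eqF].
exists (fun y => 1 * y ^- 1); first by left; exists 1, 1%N.
by move=> y /= y0; rewrite mul1r expr1; exact: is_derive1_ln.
Qed.

Lemma smooth_on_sin U f : open U -> smooth_on U f ->
  smooth_on U (fun x => sin (f x)).
Proof.
move=> Uo sf.
(* The linear span of [sin] and [cos] is closed under differentiation. *)
apply: (@smooth_on_comp
  [set phi | exists c d : R, phi = fun y => c * sin y + d * cos y] setT) => //.
  move=> psi [c [d ->]].
  exists (fun y => - d * sin y + c * cos y); first by exists (- d), c.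
  move=> y _.
  apply: (@is_derive_eq _ _ _ (c \*: @sin R + d \*: @cos R)).
  by rewrite -![_ *: _]/(_ * _); ring.
by exists 1, 0; apply/funext => y; rewrite mul1r mul0r addr0.
Qed.

End SmoothFunctions.

(** * Fields depending on r and theta only *)

Lemma ord4_ind (P : 'I_4 -> Prop) :
  P i_t -> P i_r -> P i_th -> P i_ph -> forall i, P i.
Proof.
move=> Pt Pr Pth Pph [[|[|[|[|m]]]] Hi] //.
- by rewrite (_ : Ordinal Hi = i_t)//; exact: val_inj.
- by rewrite (_ : Ordinal Hi = i_r)//; exact: val_inj.
- by rewrite (_ : Ordinal Hi = i_th)//; exact: val_inj.
- by rewrite (_ : Ordinal Hi = i_ph)//; exact: val_inj.
Qed.

Lemma sum_ord4 (V : nmodType) (F : 'I_4 -> V) :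
  \sum_(i < 4) F i = F i_t + F i_r + F i_th + F i_ph.
Proof.
rewrite !big_ord_recl big_ord0 addr0 !addrA.
by congr (_ + _ + _ + _); congr F; exact: val_inj.
Qed.

Section CoordinateDerivatives.
Context {R : realType}.
Implicit Types (F : R -> R -> R) (i : 'I_4) (x : 'rV[R]_4).

(** Moving along direction [i] changes only coordinate [i], so a function of r and theta is constant
    along t and phi; hence the clause [d = 0]. Once [i] is a concrete index, what remains is a
    one-variable statement. *)
Definition coord_derive i F (r th d : R) : Prop :=
  if i == i_r then is_derive r 1 (F^~ th) d
  else if i == i_th then is_derive th 1 (F r) d else d = 0.

Lemma partial_coord_derive i F x d :
  coord_derive i F (x 0 i_r) (x 0 i_th) d ->
  partial i (fun y => F (y 0 i_r) (y 0 i_th)) x = d.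
Proof.
rewrite /partial derive_along_line /=.
under eq_fun do rewrite !mxE !eqxx !andTb.
move: i; apply: ord4_ind => /=.
- move=> ->; under eq_fun do rewrite !mulr0 !add0r; exact: derive_cst.
- move=> [_ <-]; rewrite [RHS]derive_along_line.
  by under eq_fun do rewrite mulr0 add0r.
- move=> [_ <-]; rewrite [RHS]derive_along_line.
  by under eq_fun do rewrite mulr0 add0r.
- move=> ->; under eq_fun do rewrite !mulr0 !add0r; exact: derive_cst.
Qed.

Lemma partial_coord_derive_on (U : set 'rV[R]_4) f i F x d : open U -> U x ->
  (forall y, U y -> f y = F (y 0 i_r) (y 0 i_th)) ->
  coord_derive i F (x 0 i_r) (x 0 i_th) d -> partial i f x = d.
Proof.
by move=> Uo Ux fF /partial_coord_derive <-; exact: partial_eq_on Ux fF.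
Qed.

End CoordinateDerivatives.

(** * Spherically symmetric static metrics *)

Section WarpedMetric.
Context {R : realType}.
Implicit Types (r th : R) (i j k l : 'I_4).
Variables (a b c a1 b1 c1 a2 b2 c2 : R -> R).

(** Indexed by natural numbers so that the match reduces by computation once [ord4_ind] has made the
    index concrete. *)
Definition warped_entry (i : nat) (r th : R) : R :=
  match i with
  | 0 => a r | 1 => b r | 2 => c r | _ => (c r * sin th ^+ 2)%R
  end%N.

Definition warped_metric : tensor2_field R 4 := fun x => \matrix_(i, j)
  if i == j then warped_entry i (x 0 i_r) (x 0 i_th) else 0.

(* [warped_entry' k i] is the derivative of [warped_entry i] along the [k]-th
   coordinate, with [a1], [b1], [c1] the derivatives of [a], [b], [c]. *)
Definition warped_entry' (k i : nat) (r th : R) : R :=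
  match k, i with
  | 1, 0 => a1 r | 1, 1 => b1 r | 1, 2 => c1 r | 1, 3 => (c1 r * sin th ^+ 2)%R
  | 2, 3 => (c r * (2 * sin th * cos th))%R
  | _, _ => 0%R
  end%N.

(* Gamma^t_{tr}, Gamma^r_{tt}, Gamma^r_{rr}, Gamma^r_{theta theta} and
   Gamma^theta_{r theta} = Gamma^phi_{r phi} *)
Definition gam_t r := a1 r / (2 * a r).
Definition gam_rt r := - a1 r / (2 * b r).
Definition gam_rr r := b1 r / (2 * b r).
Definition gam_rs r := - c1 r / (2 * b r).
Definition gam_s r := c1 r / (2 * c r).

(* [warped_christoffel i j k] is Gamma^i_{jk}, the indices 0, 1, 2, 3 standing
   for t, r, theta, phi. *)
Definition warped_christoffel (i j k : nat) (r th : R) : R :=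
  match i, j, k with
  | 0, 0, 1 | 0, 1, 0 => gam_t r
  | 1, 0, 0 => gam_rt r
  | 1, 1, 1 => gam_rr r
  | 1, 2, 2 => gam_rs r
  | 1, 3, 3 => (gam_rs r * sin th ^+ 2)%R
  | 2, 1, 2 | 2, 2, 1 | 3, 1, 3 | 3, 3, 1 => gam_s r
  | 2, 3, 3 => (- (sin th * cos th))%R
  | 3, 2, 3 | 3, 3, 2 => (cos th / sin th)%R
  | _, _, _ => 0%R
  end%N.

Variables (U : set 'rV[R]_4) (g : tensor2_field R 4).
Hypothesis Uo : open U.
Hypothesis gE : forall x, U x -> g x = warped_metric x.
Hypothesis da : forall x, U x -> is_derive (x 0 i_r) 1 a (a1 (x 0 i_r)).
Hypothesis db : forall x, U x -> is_derive (x 0 i_r) 1 b (b1 (x 0 i_r)).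
Hypothesis dc : forall x, U x -> is_derive (x 0 i_r) 1 c (c1 (x 0 i_r)).
Hypothesis a_neq0 : forall x, U x -> a (x 0 i_r) != 0.
Hypothesis b_neq0 : forall x, U x -> b (x 0 i_r) != 0.
Hypothesis c_neq0 : forall x, U x -> c (x 0 i_r) != 0.
Hypothesis sin_neq0 : forall x, U x -> sin (x 0 i_th) != 0.

Lemma warped_entry_neq0 i x : U x -> warped_entry i (x 0 i_r) (x 0 i_th) != 0.
Proof.
move=> Ux; move: i; apply: ord4_ind => /=; auto.
by rewrite mulf_neq0 ?expf_neq0; auto.
Qed.

(** An explicit right inverse gives both invertibility and the formula for [invmx], with no
    determinant to compute. *)
Lemma warped_mul_inv x : U x ->
  g x *m (\matrix_(i, j) if i == j then (warped_entry i (x 0 i_r) (x 0 i_th))^-1 else 0)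
  = 1%:M.
Proof.
move=> Ux; rewrite gE//; apply/matrixP => i j; rewrite !mxE.
rewrite (bigD1 i)//= big1 => [|k ki]; last first.
  by rewrite !mxE [i == k]eq_sym (negPf ki) mul0r.
rewrite !mxE eqxx addr0; case: eqVneq => ij; last by rewrite mulr0.
by rewrite divff// warped_entry_neq0.
Qed.

Lemma warped_unit x : U x -> g x \in unitmx.
Proof. by move=> /warped_mul_inv/mulmx1_unit[]. Qed.

Lemma warped_inv x i j : U x -> invmx (g x) i j =
  if i == j then (warped_entry i (x 0 i_r) (x 0 i_th))^-1 else 0.
Proof.
move=> Ux; have E := warped_mul_inv Ux.
have -> : invmx (g x) = \matrix_(i, j)
    if i == j then (warped_entry i (x 0 i_r) (x 0 i_th))^-1 else 0.
  by rewrite -[LHS]mulmx1 -E mulmxA mulVmx ?mul1mx// warped_unit.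
by rewrite mxE.
Qed.

Lemma coord_derive0 i r th : coord_derive i (fun _ _ => 0) r th 0.
Proof. by move: i; apply: ord4_ind => //=; exact: is_derive_const. Qed.

Lemma is_derive_sin_sqr th : is_derive th 1 (fun y => sin y ^+ 2) (2 * sin th * cos th).
Proof. exact: is_derive_pow (is_derive_sin th). Qed.

Lemma partial_warped k i j x : U x ->
  partial k (fun y => g y i j) x =
  if i == j then warped_entry' k i (x 0 i_r) (x 0 i_th) else 0.
Proof.
move=> Ux; apply: (partial_coord_derive_on Uo Ux
    (F := fun r th => if i == j then warped_entry i r th else 0)).
  by move=> y Uy; rewrite gE// mxE.
case: (i == j); last exact: coord_derive0.
have cst := @is_derive_const R.
move: i k; do 2!apply: ord4_ind => //=;
  try solve [exact: cst | exact: (da Ux) | exact: (db Ux) | exact: (dc Ux)].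
- refine (is_derive_eq (is_derive_mul (dc Ux) (cst (sin (x 0 i_th) ^+ 2) _)) _).
  by ring.
- refine (is_derive_eq (is_derive_mul (cst (c (x 0 i_r)) _) (is_derive_sin_sqr _)) _).
  by ring.
Qed.

Lemma christoffel_warped i j k x : U x ->
  christoffel g i j k x = warped_christoffel i j k (x 0 i_r) (x 0 i_th).
Proof.
(* The inverse metric is diagonal, so only the summand [d = i] survives. *)
move=> Ux; rewrite /christoffel (bigD1 i)//= big1 => [|d di]; last first.
  by rewrite warped_inv// eq_sym (negPf di) mul0r.
rewrite addr0 warped_inv// eqxx !partial_warped//.
have := (a_neq0 Ux, b_neq0 Ux, c_neq0 Ux, sin_neq0 Ux).
move: i j k; do 3!apply: ord4_ind => //=; move=> [[[a0 b0] c0] s0];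
  rewrite /gam_t /gam_rt /gam_rr /gam_rs /gam_s; field;
  by rewrite ?a0 ?b0 ?c0 ?s0.
Qed.

Hypothesis da1 : forall x, U x -> is_derive (x 0 i_r) 1 a1 (a2 (x 0 i_r)).
Hypothesis db1 : forall x, U x -> is_derive (x 0 i_r) 1 b1 (b2 (x 0 i_r)).
Hypothesis dc1 : forall x, U x -> is_derive (x 0 i_r) 1 c1 (c2 (x 0 i_r)).

Definition gam_t' r := (a2 r * a r - a1 r ^+ 2) / (2 * a r ^+ 2).
Definition gam_rt' r := (a1 r * b1 r - a2 r * b r) / (2 * b r ^+ 2).
Definition gam_rr' r := (b2 r * b r - b1 r ^+ 2) / (2 * b r ^+ 2).
Definition gam_rs' r := (c1 r * b1 r - c2 r * b r) / (2 * b r ^+ 2).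
Definition gam_s' r := (c2 r * c r - c1 r ^+ 2) / (2 * c r ^+ 2).

(** All five radial Christoffel functions have the shape p / (2 q), so one quotient rule serves them
    all. *)
Lemma is_derive_gam (p q : R -> R) r p' q' : q r != 0 ->
  is_derive r 1 p p' -> is_derive r 1 q q' ->
  is_derive r 1 (fun y => p y / (2 * q y))
    ((p' * q r - p r * q') / (2 * q r ^+ 2)).
Proof.
move=> q0 dp dq; have d2q := is_derive_mul (is_derive_const 2 r) dq.
have nz : 2 * q r != 0 by rewrite mulf_neq0// pnatr_eq0.
refine (is_derive_eq (is_derive_mul dp (is_derive_inv d2q nz)) _).
by field.
Qed.

(* [warped_christoffel' l i j k] is d_l Gamma^i_{jk}. *)
Definition warped_christoffel' (l i j k : nat) (r th : R) : R :=
  match l, i, j, k with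
  | 1, 0, 0, 1 | 1, 0, 1, 0 => gam_t' r
  | 1, 1, 0, 0 => gam_rt' r
  | 1, 1, 1, 1 => gam_rr' r
  | 1, 1, 2, 2 => gam_rs' r
  | 1, 1, 3, 3 => (gam_rs' r * sin th ^+ 2)%R
  | 1, 2, 1, 2 | 1, 2, 2, 1 | 1, 3, 1, 3 | 1, 3, 3, 1 => gam_s' r
  | 2, 1, 3, 3 => (gam_rs r * (2 * sin th * cos th))%R
  | 2, 2, 3, 3 => (sin th ^+ 2 - cos th ^+ 2)%R
  | 2, 3, 2, 3 | 2, 3, 3, 2 => (- 1 - (cos th / sin th) ^+ 2)%R
  | _, _, _, _ => 0%R
  end%N.

(** Written as - 1 - cot^2 rather than - 1 / sin^2, so that the Ricci computation is a rational
    identity in sin and cos that never calls on sin^2 + cos^2 = 1. *)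
Lemma is_derive_cot th : sin th != 0 ->
  is_derive th 1 (fun y => cos y / sin y) (- 1 - (cos th / sin th) ^+ 2).
Proof.
move=> s0; have d := is_derive_inv (is_derive_sin th) s0.
by refine (is_derive_eq (is_derive_mul (is_derive_cos th) d) _); field.
Qed.

Lemma is_derive_sin_cos th :
  is_derive th 1 (fun y => - (sin y * cos y)) (sin th ^+ 2 - cos th ^+ 2).
Proof.
have d := is_derive_mul (is_derive_sin th) (is_derive_cos th).
by refine (is_derive_eq (is_derive_opp d) _); ring.
Qed.

Lemma partial_christoffel_warped l i j k x : U x ->
  partial l (christoffel g i j k) x =
  warped_christoffel' l i j k (x 0 i_r) (x 0 i_th).
Proof.
move=> Ux; apply: (partial_coord_derive_on Uo Ux (christoffel_warped i j k)).
have cst := @is_derive_const R.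
have d_t := is_derive_gam (a_neq0 Ux) (da1 Ux) (da Ux).
have d_rt := is_derive_gam (b_neq0 Ux) (is_derive_opp (da1 Ux)) (db Ux).
have d_rr := is_derive_gam (b_neq0 Ux) (db1 Ux) (db Ux).
have d_rs := is_derive_gam (b_neq0 Ux) (is_derive_opp (dc1 Ux)) (db Ux).
have d_s := is_derive_gam (c_neq0 Ux) (dc1 Ux) (dc Ux).
have {}d_t : is_derive (x 0 i_r) 1 gam_t (gam_t' (x 0 i_r)).
  by refine (is_derive_eq d_t _); rewrite /gam_t' expr2.
have {}d_rt : is_derive (x 0 i_r) 1 gam_rt (gam_rt' (x 0 i_r)).
  by refine (is_derive_eq d_rt _); congr (_ / _); ring.
have {}d_rr : is_derive (x 0 i_r) 1 gam_rr (gam_rr' (x 0 i_r)).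
  by refine (is_derive_eq d_rr _); rewrite /gam_rr' expr2.
have {}d_rs : is_derive (x 0 i_r) 1 gam_rs (gam_rs' (x 0 i_r)).
  by refine (is_derive_eq d_rs _); congr (_ / _); ring.
have {}d_s : is_derive (x 0 i_r) 1 gam_s (gam_s' (x 0 i_r)).
  by refine (is_derive_eq d_s _); rewrite /gam_s' expr2.
move: i j k l; do 4!apply: ord4_ind => //=;
  try solve [exact: cst | exact: d_t | exact: d_rt | exact: d_rr | exact: d_rs | exact: d_s
    | exact: is_derive_sin_cos | exact: is_derive_cot (sin_neq0 Ux)].
- refine (is_derive_eq (is_derive_mul d_rs (cst (sin (x 0 i_th) ^+ 2) _)) _).
  by ring.
- refine (is_derive_eq (is_derive_mul (cst (gam_rs (x 0 i_r)) _) (is_derive_sin_sqr _)) _).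
  by ring.
Qed.

(** The contraction of the curvature, expressed through the Christoffel functions and their
    derivatives. The summand 1 in the angular entries is the curvature of the unit sphere, left over
    from the theta-derivatives. *)
Definition warped_ricci (i : nat) (r th : R) : R :=
  match i with
  | 0 => (gam_rt' r + gam_rt r * (gam_rr r + 2 * gam_s r - gam_t r))%R
  | 1 => (- gam_t' r - 2 * gam_s' r + gam_rr r * (gam_t r + 2 * gam_s r)
          - gam_t r ^+ 2 - 2 * gam_s r ^+ 2)%R
  | 2 => (1 + gam_rs' r + gam_rs r * (gam_t r + gam_rr r))%R
  | _ => (sin th ^+ 2 * (1 + gam_rs' r + gam_rs r * (gam_t r + gam_rr r)))%R
  end%N.

Lemma ricci_warped x : U x ->
  ricci g x = \matrix_(i, j)
    if i == j then warped_ricci i (x 0 i_r) (x 0 i_th) else 0.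
Proof.
move=> Ux; apply/matrixP => i j; rewrite !mxE sum_ord4 /riemann !sum_ord4.
rewrite !partial_christoffel_warped// !christoffel_warped//.
(* The functions [gam_t], [gam_rt] and so on stay folded and act as atoms, so sin theta is the only
   denominator. *)
have := sin_neq0 Ux.
by move: i j; do 2!apply: ord4_ind => //=; move=> s0; field.
Qed.

End WarpedMetric.

(** * The Schwarzschild-de Sitter family *)

Lemma static_metric_warped {R : realType} (F : R -> R) (x : 'rV[R]_4) :
  static_metric F x =
  warped_metric (fun r => - F r) (fun r => (F r)^-1) (fun r => r ^+ 2) x.
Proof.
apply/matrixP; do 2!apply: ord4_ind; rewrite !mxE /=;
  by rewrite !(mulr0, mulr1, addr0, add0r).
Qed.

Section SchwarzschildDeSitter.
Context {R : realType}.
Variables (M lam c3 : R).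
Implicit Types (r : R) (x y : 'rV[R]_4).

Let h r := 1 + c3 * r.
Let f := f_profile M lam c3.

Lemma f_profileE r : r != 0 -> h r != 0 ->
  f r = h r ^+ 2 * sds_profile M lam (r / h r).
Proof.
move=> r0 h0; rewrite /f /f_profile /sds_profile -/(h r).
by field; rewrite ?h0 ?r0.
Qed.

Let h_derive r : is_derive r 1 h c3.
Proof.
refine (is_derive_eq (is_derive_add (is_derive_const 1 r)
  (is_derive_mul (is_derive_const c3 r) (is_derive_var r))) _).
by ring.
Qed.

Let inv_h_derive r : h r != 0 ->
  is_derive r 1 (fun r => (h r)^-1) (- c3 / h r ^+ 2).
Proof. exact: is_derive_inv (h_derive r). Qed.

Definition f_profile' r : R :=
  2 * c3 * h r + 2 * M / r ^+ 2 * h r ^+ 3 - 6 * M * c3 / r * h r ^+ 2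
  - 2 * lam / 3 * r.

Lemma is_derive_f_profile r : r != 0 -> is_derive r 1 f (f_profile' r).
Proof.
move=> r0.
have d1 := is_derive_pow 2 (h_derive r).
have d2 := is_derive_mul (is_derive_mul (is_derive_const (2 * M) r)
  (is_derive_inv (is_derive_var r) r0)) (is_derive_pow 3 (h_derive r)).
have d3 := is_derive_mul (is_derive_const (lam / 3) r)
  (is_derive_pow 2 (is_derive_var r)).
refine (is_derive_eq (is_derive_add (is_derive_add d1 (is_derive_opp d2))
  (is_derive_opp d3)) _).
by rewrite /f_profile' /=; field.
Qed.

(** * The profile at the rescaled radius and its derivatives *)

Let s r := r / h r.
Let P r := sds_profile M lam (s r).
Let P' r := 2 * M / r ^+ 2 - 2 * lam / 3 * r / h r ^+ 3.
Let P'' r := - (4 * M) / r ^+ 3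
  - 2 * lam / 3 * ((h r ^+ 3)^-1 - 3 * c3 * r / h r ^+ 4).

Let s_derive r : h r != 0 -> is_derive r 1 s ((h r ^+ 2)^-1).
Proof.
move=> h0.
refine (is_derive_eq (is_derive_mul (is_derive_var r) (inv_h_derive h0)) _).
(* Removing [c3] in favour of [h r] allows [h r] to be generalized to an atom before [field]. *)
have E : c3 * r = h r - 1 by rewrite /h; ring.
rewrite mulrA [r * _]mulrC mulNr E.
by move: (h r) h0 => k k0; field.
Qed.

Let P_derive r : r != 0 -> h r != 0 -> is_derive r 1 P (P' r).
Proof.
move=> r0 h0; have ds := s_derive h0.
have s0 : s r != 0 by rewrite mulf_neq0 ?invr_neq0.
have d1 := is_derive_mul (is_derive_const (2 * M) r) (is_derive_inv ds s0).
have d2 := is_derive_mul (is_derive_const (lam / 3) r) (is_derive_pow 2 ds).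
refine (is_derive_eq (is_derive_add (is_derive_add (is_derive_const 1 r)
  (is_derive_opp d1)) (is_derive_opp d2)) _).
rewrite /P' /s /=.
by move: (h r) h0 => k k0; field; rewrite ?k0 ?r0.
Qed.

Let P'_derive r : r != 0 -> h r != 0 -> is_derive r 1 P' (P'' r).
Proof.
move=> r0 h0.
have d1 := is_derive_mul (is_derive_const (2 * M) r)
  (is_derive_inv (is_derive_pow 2 (is_derive_var r)) (expf_neq0 2 r0)).
have d2 := is_derive_mul
  (is_derive_mul (is_derive_const (2 * lam / 3) r) (is_derive_var r))
  (is_derive_inv (is_derive_pow 3 (h_derive r)) (expf_neq0 3 h0)).
refine (is_derive_eq (is_derive_add d1 (is_derive_opp d2)) _).
rewrite /P'' /=.
by move: (h r) h0 => k k0; field; rewrite ?k0 ?r0.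
Qed.

(** * Coefficients of e^(2u) g and their Ricci entries *)

Let a r := - P r.
Let a1 r := - P' r.
Let a2 r := - P'' r.
Let B r := P r * h r ^+ 4.
Let B' r := P' r * h r ^+ 4 + 4 * c3 * P r * h r ^+ 3.
Let B'' r := P'' r * h r ^+ 4 + 8 * c3 * P' r * h r ^+ 3
  + 12 * c3 ^+ 2 * P r * h r ^+ 2.
Let b r := (B r)^-1.
Let b1 r := - B' r / B r ^+ 2.
Let b2 r := 2 * B' r ^+ 2 / B r ^+ 3 - B'' r / B r ^+ 2.
Let c r := s r ^+ 2.
Let c1 r := 2 * r / h r ^+ 3.
Let c2 r := 2 / h r ^+ 3 - 6 * c3 * r / h r ^+ 4.

Let B_derive r : r != 0 -> h r != 0 -> is_derive r 1 B (B' r).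
Proof.
move=> r0 h0.
refine (is_derive_eq (is_derive_mul (P_derive r0 h0)
  (is_derive_pow 4 (h_derive r))) _).
by rewrite /B' /=; ring.
Qed.

Let B'_derive r : r != 0 -> h r != 0 -> is_derive r 1 B' (B'' r).
Proof.
move=> r0 h0.
have d1 := is_derive_mul (P'_derive r0 h0) (is_derive_pow 4 (h_derive r)).
have d2 := is_derive_mul (is_derive_mul (is_derive_const (4 * c3) r)
  (P_derive r0 h0)) (is_derive_pow 3 (h_derive r)).
refine (is_derive_eq (is_derive_add d1 d2) _).
by rewrite /B'' /=; ring.
Qed.

Let c_derive r : h r != 0 -> is_derive r 1 c (c1 r).
Proof.
move=> h0; refine (is_derive_eq (is_derive_pow 2 (s_derive h0)) _).
by rewrite /c1 /s /=; move: (h r) h0 => k k0; field.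
Qed.

Let c1_derive r : h r != 0 -> is_derive r 1 c1 (c2 r).
Proof.
move=> h0; refine (is_derive_eq (is_derive_mul
  (is_derive_mul (is_derive_const 2 r) (is_derive_var r))
  (is_derive_inv (is_derive_pow 3 (h_derive r)) (expf_neq0 3 h0))) _).
by rewrite /c2 /=; move: (h r) h0 => k k0; field.
Qed.

Let b1_derive r : r != 0 -> h r != 0 -> P r != 0 -> is_derive r 1 b1 (b2 r).
Proof.
move=> r0 h0 P0.
have B0 : B r != 0 by rewrite mulf_neq0 ?expf_neq0.
refine (is_derive_eq (is_derive_mul (is_derive_opp (B'_derive r0 h0))
  (is_derive_inv (is_derive_pow 2 (B_derive r0 h0)) (expf_neq0 2 B0))) _).
by rewrite /b2 /=; move: (B r) (B' r) (B'' r) B0 => k k' k'' k0; field.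
Qed.

Let ricci_entries i r th : r != 0 -> h r != 0 -> P r != 0 ->
  warped_ricci a b c a1 b1 c1 a2 c2 i r th
    = lam * warped_entry a b c i r th.
Proof.
move=> r0 h0 P0.
(* Eliminating [M] instead of [P r] keeps the denominators in the [field]
   problems below monomial in [P r]. *)
have ME : M = (1 - P r - lam / 3 * s r ^+ 2) * s r / 2.
  by rewrite /P /sds_profile; field; rewrite mulf_neq0 ?invr_neq0.
(* The cancellations below depend on how [h r], [c3] and [r] are related, so [h r] is expanded for
   [field] and folded back only in the side conditions. *)
have hE : h r = 1 + c3 * r by [].
(* The theta equation, isolated because the phi equation is sin^2 theta times it. *)
have R22 : 1 + gam_rs' b b1 c1 c2 r + gam_rs b c1 r * (gam_t a a1 r + gam_rr b b1 r)
    = lam * c r.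
  rewrite /gam_rs' /gam_rs /gam_t /gam_rr /a /b /c /a1 /b1 /c1 /c2 /B' /B /P'.
  rewrite {}ME; move: (P r) P0 => p p0.
  rewrite /s hE; field.
  by rewrite -hE r0 h0 p0.
case: i => [|[|[|i]]]; rewrite /warped_ricci /warped_entry.
- rewrite /gam_rt' /gam_rt /gam_rr /gam_s /gam_t /a /b /c /a1 /a2 /b1 /c1 /B' /B /P' /P''.
  rewrite {}ME; move: (P r) P0 => p p0.
  rewrite /s hE; field.
  by rewrite -hE r0 h0 p0.
- rewrite /gam_t' /gam_s' /gam_rr /gam_s /gam_t /a /b /c /a1 /a2 /b1 /c1 /c2 /B' /B /P' /P''.
  rewrite {}ME; move: (P r) P0 => p p0.
  rewrite /s hE; field.
  by rewrite -hE r0 h0 p0.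
- exact: R22.
- by rewrite R22; ring.
Qed.

(** * The soliton equation for e^(2u) g on the region *)

Variable U : set 'rV[R]_4.
Hypothesis Uo : open U.
Hypothesis U_region : forall x, U x ->
  [/\ 0 < x 0 i_r, 0 < f (x 0 i_r), 0 < h (x 0 i_r) & sin (x 0 i_th) != 0].

Let g := static_metric f.
Let u : scalar_field R 4 := u_field c3.
Let Y := @Y_field R.
Let xi := @coord_vector R 4 i_t.
Let Phi := rescale_r u.

Let r_neq0 x : U x -> x 0 i_r != 0.
Proof. by move=> /U_region[r0 _ _ _]; rewrite gt_eqF. Qed.

Let h_neq0 x : U x -> h (x 0 i_r) != 0.
Proof. by move=> /U_region[_ _ h0 _]; rewrite gt_eqF. Qed.

Let f_neq0 x : U x -> f (x 0 i_r) != 0.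
Proof. by move=> /U_region[_ f0 _ _]; rewrite gt_eqF. Qed.

Let sin_neq0 x : U x -> sin (x 0 i_th) != 0.
Proof. by case/U_region. Qed.

Let P_gt0 x : U x -> 0 < P (x 0 i_r).
Proof.
move=> Ux; have [_ f0 h0 _] := U_region Ux.
move: f0; rewrite f_profileE ?r_neq0 ?h_neq0//.
by rewrite pmulr_rgt0// exprn_gt0.
Qed.

Let P_neq0 x : U x -> P (x 0 i_r) != 0.
Proof. by move=> /P_gt0 P0; rewrite gt_eqF. Qed.

Lemma expR_u_field x : U x -> expR (u x) = (h (x 0 i_r))^-1.
Proof.
by move=> /U_region[_ _ h0 _]; rewrite /u /u_field expRN lnK.
Qed.

Lemma conformal_static_warped x : U x ->
  conformal_metric u g x = warped_metric a b c x.
Proof.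
move=> Ux; rewrite /conformal_metric /g static_metric_warped.
rewrite mulr_natl mulr2n expRD expR_u_field//.
have fE := f_profileE (r_neq0 Ux) (h_neq0 Ux).
rewrite -/f -/(h _) -/(s _) -/(P _) in fE.
apply/matrixP => i j; rewrite !mxE; case: eqP => _; last by rewrite mulr0.
have := (r_neq0 Ux, h_neq0 Ux, P_neq0 Ux).
rewrite /warped_entry fE /a /b /B /c /s.
move: (x 0 i_r) (x 0 i_th) => r th; move: (P r) (h r) => p k [[r0 k0] p0].
by case: (nat_of_ord i) => [|[|[|m]]]; field; rewrite ?k0 ?p0.
Qed.

Let warped_a_neq0 x : U x -> a (x 0 i_r) != 0.
Proof. by move=> Ux; rewrite oppr_eq0 P_neq0. Qed.

Let warped_b_neq0 x : U x -> b (x 0 i_r) != 0.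
Proof. by move=> Ux; rewrite invr_neq0// mulf_neq0 ?expf_neq0 ?P_neq0 ?h_neq0. Qed.

Let warped_c_neq0 x : U x -> c (x 0 i_r) != 0.
Proof. by move=> Ux; rewrite expf_neq0// mulf_neq0 ?invr_neq0 ?r_neq0 ?h_neq0. Qed.

Let b_derive r : r != 0 -> h r != 0 -> P r != 0 -> is_derive r 1 b (b1 r).
Proof.
move=> r0 h0 P0; apply: is_derive_inv; first exact: B_derive.
by rewrite mulf_neq0 ?expf_neq0.
Qed.

Let da x : U x -> is_derive (x 0 i_r) 1 a (a1 (x 0 i_r)).
Proof. by move=> Ux; apply/is_derive_opp/P_derive; auto. Qed.

Let db x : U x -> is_derive (x 0 i_r) 1 b (b1 (x 0 i_r)).
Proof. by move=> Ux; apply: b_derive; auto. Qed.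

Let dc x : U x -> is_derive (x 0 i_r) 1 c (c1 (x 0 i_r)).
Proof. by move=> Ux; apply: c_derive; auto. Qed.

Let da1 x : U x -> is_derive (x 0 i_r) 1 a1 (a2 (x 0 i_r)).
Proof. by move=> Ux; apply/is_derive_opp/P'_derive; auto. Qed.

Let db1 x : U x -> is_derive (x 0 i_r) 1 b1 (b2 (x 0 i_r)).
Proof. by move=> Ux; apply: b1_derive; auto. Qed.

Let dc1 x : U x -> is_derive (x 0 i_r) 1 c1 (c2 (x 0 i_r)).
Proof. by move=> Ux; apply: c1_derive; auto. Qed.

Lemma ricci_conformal_static x : U x ->
  ricci (conformal_metric u g) x = lam *: conformal_metric u g x.
Proof.
move=> Ux; rewrite (ricci_warped Uo conformal_static_warped da db dc
  warped_a_neq0 warped_b_neq0 warped_c_neq0 sin_neq0 da1 db1 dc1)//.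
rewrite conformal_static_warped//; apply/matrixP => i j; rewrite !mxE.
by case: eqP; rewrite ?mulr0// ricci_entries ?r_neq0 ?h_neq0 ?P_neq0.
Qed.

Lemma lie_derivative_conformal_static x : U x ->
  lie_derivative2 xi (conformal_metric u g) x = 0.
Proof.
move=> Ux; apply/matrixP => i j; rewrite !mxE big1// => k _.
have pxi l : partial l (fun y => xi y 0 k) x = 0 by exact: derive_cst.
rewrite !pxi !mulr0 !addr0 mxE.
rewrite (partial_warped Uo conformal_static_warped da db dc)//.
by move: k {pxi}; apply: ord4_ind; rewrite ?mul0r//= if_same mulr0.
Qed.

(** * The metric g and the conformal Killing-Yano equation *)

Let ag r := - f r.
Let bg r := (f r)^-1.
Let cg r := r ^+ 2.
Let ag1 r := - f_profile' r.
Let bg1 r := - f_profile' r / f r ^+ 2.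
Let cg1 r := 2 * r.

Let g_warped x : U x -> g x = warped_metric ag bg cg x.
Proof. by move=> _; exact: static_metric_warped. Qed.

Let dag x : U x -> is_derive (x 0 i_r) 1 ag (ag1 (x 0 i_r)).
Proof. by move=> Ux; apply/is_derive_opp/is_derive_f_profile; auto. Qed.

Let dbg x : U x -> is_derive (x 0 i_r) 1 bg (bg1 (x 0 i_r)).
Proof.
move=> Ux; apply: is_derive_inv; last exact: f_neq0.
exact/is_derive_f_profile/r_neq0.
Qed.

Let dcg x : U x -> is_derive (x 0 i_r) 1 cg (cg1 (x 0 i_r)).
Proof.
move=> Ux; refine (is_derive_eq (is_derive_pow 2 (is_derive_var _)) _).
by rewrite expr1 mulr1.
Qed.

Let ag_neq0 x : U x -> ag (x 0 i_r) != 0.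
Proof. by move=> Ux; rewrite oppr_eq0 f_neq0. Qed.

Let bg_neq0 x : U x -> bg (x 0 i_r) != 0.
Proof. by move=> Ux; rewrite invr_neq0 ?f_neq0. Qed.

Let cg_neq0 x : U x -> cg (x 0 i_r) != 0.
Proof. by move=> Ux; rewrite expf_neq0 ?r_neq0. Qed.

Let g_christoffel := christoffel_warped Uo g_warped dag dbg dcg
  ag_neq0 bg_neq0 cg_neq0 sin_neq0.

Let g_inv := warped_inv g_warped ag_neq0 bg_neq0 cg_neq0 sin_neq0.

Lemma partial_Y_field k i j x :
  partial k (fun y => Y y i j) x = (k == i_r)%:R * dwedge R i_t i_r i j.
Proof.
rewrite (_ : (fun y => _) = fun y => y 0 i_r * dwedge R i_t i_r i j); last first.
  by apply/funext => y; rewrite [LHS]mxE.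
apply: (partial_coord_derive (F := fun r _ => r * dwedge R i_t i_r i j)).
move: k; apply: ord4_ind; rewrite /coord_derive /= ?mul0r//.
- refine (is_derive_eq (is_derive_mul (is_derive_var _) (is_derive_const _ _)) _).
  by rewrite mulr0 add0r mulrC.
- exact: is_derive_const.
Qed.

(** The coefficient of [Y] depends on r alone and [Y] already contains dr, so dY has a repeated
    factor dr. *)
Lemma closed_Y_field : closed_2form_on U Y.
Proof.
move=> x _ i j k; rewrite /ext_derivative2 !partial_Y_field.
by move: i j k; do 3!apply: ord4_ind; rewrite !mxE /=; ring.
Qed.

(** The covector obtained by lowering d/dt with g. It serves as a candidate: the derivative of [Y]
    is expressed through it first, and the divergence is identified with it afterwards. *)
Let xi_flat (i : 'I_4) r : R := if i == i_t then - f r else 0.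

(** Since g_tt g_rr = -1, Gamma^t_{tr} + Gamma^r_{rr} = 0 and f' drops out, leaving nabla_r Y_tr =
    1. The angular components come from Gamma^r_{theta theta} = - r f. *)
Lemma nabla2_Y_field k i j x : U x ->
  nabla2 g Y k i j x = g x k i * xi_flat j (x 0 i_r) - g x k j * xi_flat i (x 0 i_r).
Proof.
move=> Ux; rewrite /nabla2 partial_Y_field !sum_ord4 !g_christoffel// g_warped//.
have := (r_neq0 Ux, f_neq0 Ux, sin_neq0 Ux).
rewrite /Y /Y_field !mxE.
move: (x 0 i_r) (x 0 i_th) => r th.
move: i j k; do 3!apply: ord4_ind; rewrite /xi_flat /=; move=> [[r0 f0] s0];
  rewrite /gam_t /gam_rt /gam_rr /gam_rs /gam_s
    /ag /bg /cg /ag1 /bg1 /cg1; field; by rewrite ?f0 ?r0 ?s0.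
Qed.

(** Contracting the formula for the derivative of [Y] with the inverse metric gives (4 - 1) xi_a,
    which the normalization by n - 1 cancels. *)
Lemma assoc_covector_Y_field i x : U x ->
  assoc_covector g Y i x = xi_flat i (x 0 i_r).
Proof.
move=> Ux; rewrite /assoc_covector !sum_ord4 !g_inv//= !nabla2_Y_field// !g_warped//.
have := (r_neq0 Ux, f_neq0 Ux, sin_neq0 Ux).
rewrite !mxE; move: (x 0 i_r) (x 0 i_th) => r th.
move: i; apply: ord4_ind; rewrite /xi_flat /=; move=> [[r0 f0] s0];
  rewrite /ag /bg /cg; field; by rewrite ?f0 ?r0 ?s0.
Qed.

Lemma assoc_vector_Y_field x : U x -> assoc_vector g Y x = xi x.
Proof.
move=> Ux; apply/rowP => i; rewrite !mxE sum_ord4 !g_inv// !assoc_covector_Y_field//.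
have := (r_neq0 Ux, f_neq0 Ux, sin_neq0 Ux).
move: (x 0 i_r) (x 0 i_th) => r th; rewrite /xi_flat.
move: i; apply: ord4_ind => /= -[[r0 f0] s0];
  rewrite /ag /bg /cg; field; by rewrite ?f0 ?r0 ?s0.
Qed.

(** * Smoothness and assembly of the CKY-RS structure *)

Let smooth_r : smooth_on U (fun x => x 0 i_r) := smooth_on_coord U i_r.

Let smooth_h : smooth_on U (fun x => h (x 0 i_r)).
Proof.
apply: smooth_onD => //; first exact: smooth_on_cst.
by apply: smooth_onM => //; exact: smooth_on_cst.
Qed.

Let smooth_f : smooth_on U (fun x => f (x 0 i_r)).
Proof.
apply: smooth_onD => //; first apply: smooth_onD => //.
- exact: smooth_onX.
- apply: smooth_onN => //; apply: smooth_onM => //; last exact: smooth_onX.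
  apply: smooth_onM => //; first exact: smooth_on_cst.
  by apply: smooth_onV => //; exact: r_neq0.
- apply: smooth_onN => //; apply: smooth_onM => //; last exact: smooth_onX.
  exact: smooth_on_cst.
Qed.

Lemma static_pseudo_riemannian : pseudo_riemannian_metric U g.
Proof.
split.
- move=> i j; apply: (@smooth_on_eq _ _ _ (fun x => if i == j then
      warped_entry ag bg cg i (x 0 i_r) (x 0 i_th) else 0)) => //.
    by move=> x Ux; rewrite g_warped// mxE.
  case: (i == j); last exact: smooth_on_cst.
  move: i; apply: ord4_ind => /=.
  + exact: smooth_onN.
  + exact: smooth_onV.
  + exact: smooth_onX.
  + apply: smooth_onM => //; apply: smooth_onX => //; apply: smooth_on_sin => //.
    exact: smooth_on_coord.
- by move=> x Ux i j; rewrite g_warped// !mxE eq_sym; case: eqP => // ->.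
- by move=> x Ux; apply: (warped_unit g_warped).
Qed.

Lemma smooth_u_field : smooth_on U u.
Proof.
apply: smooth_onN => //; apply: smooth_on_ln => //.
by move=> x /U_region[].
Qed.

Lemma cky_Y_field : cky_2form U g Y.
Proof.
split; first split.
- move=> i j; apply: (@smooth_on_eq _ _ _ (fun x => x 0 i_r * dwedge R i_t i_r i j)) => //.
    by move=> x _; rewrite [RHS]mxE.
  by apply: smooth_onM => //; exact: smooth_on_cst.
- by move=> x _; do 2!apply: ord4_ind; rewrite !mxE /=; ring.
- exists (fun _ _ _ _ => 0) => x Ux; split.
    by move=> i j k; rewrite oppr0.
  by move=> i j k; rewrite addr0 nabla2_Y_field// !assoc_covector_Y_field.
Qed.

Lemma static_cky_rs_structure : cky_rs_structure U g u Y xi lam.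
Proof.
split => //.
- exact: static_pseudo_riemannian.
- exact: smooth_u_field.
- exact: cky_Y_field.
- by move=> x Ux; rewrite assoc_vector_Y_field.
- by move=> x Ux; rewrite ricci_conformal_static// lie_derivative_conformal_static// scaler0 addr0.
Qed.

(** * The radial rescaling as a diffeomorphism, and the pullback *)

Let PhiE x i : U x -> Phi x 0 i = if i == i_r then s (x 0 i_r) else x 0 i.
Proof.
by move=> Ux; rewrite mxE expR_u_field// [_^-1 * _]mulrC.
Qed.

Let k y := 1 - c3 * y 0 i_r.
(** Solving y = r / (1 + c3 r) for r gives y / (1 - c3 y). Writing the inverse map as the identity
    plus a multiple of a basis vector makes its continuity follow from that of sums and scalings. *)
Let Psi y : 'rV[R]_4 := y + (y 0 i_r / k y - y 0 i_r) *: delta_mx 0 i_r.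

Let PsiE y i : Psi y 0 i = if i == i_r then y 0 i_r / k y else y 0 i.
Proof.
rewrite !mxE eqxx /=; case: eqP => [->|_]; first by rewrite mulr1 addrC subrK.
by rewrite mulr0 addr0.
Qed.

Let k_Phi x : U x -> k (Phi x) = (h (x 0 i_r))^-1.
Proof.
move=> Ux; rewrite /k PhiE//= /s; have := h_neq0 Ux; rewrite /h => h0.
by field.
Qed.

Let k_gt0 y : (Phi @` U) y -> 0 < k y.
Proof.
by move=> [x Ux <-]; rewrite k_Phi// invr_gt0; case: (U_region Ux).
Qed.

Let Phi_K x : U x -> Psi (Phi x) = x.
Proof.
move=> Ux; apply/rowP => i; rewrite PsiE k_Phi// !PhiE// eqxx.
by case: eqP => [->|//]; rewrite invrK divfK// h_neq0.
Qed.

Let Psi_K y : U (Psi y) -> 0 < k y -> Phi (Psi y) = y.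
Proof.
move=> UP k0; apply/rowP => i; rewrite PhiE// !PsiE eqxx.
case: eqP => [->|//].
have k0' : k y != 0 by rewrite gt_eqF.
have hk : h (y 0 i_r / k y) = (k y)^-1.
  by move: k0'; rewrite /h /k => k0'; field.
by rewrite /s hk invrK divfK.
Qed.

(** By continuity of [Psi] and [k], points [z] near a point of the image still satisfy [U (Psi z)]
    and [0 < k z], and then [z] is the image of [Psi z]. *)
Lemma open_image_rescale : open (Phi @` U).
Proof.
rewrite openE => y Vy; rewrite /interior.
have ky := k_gt0 Vy.
have ck : {for y, continuous k}.
  apply: continuousB; first exact: cst_continuous.
  by apply: continuousM; [exact: cst_continuous|exact: coord_continuous].
have cPsi : {for y, continuous Psi}.
  apply: continuousD; first exact: cvg_id.
  apply: continuousZ; last exact: cst_continuous.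
  apply: continuousB; last exact: coord_continuous.
  apply: continuousM; first exact: coord_continuous.
  by apply: continuousV => //; rewrite gt_eqF.
have UPsi : U (Psi y) by case: Vy => x Ux <-; rewrite Phi_K.
have nU : \forall z \near y, U (Psi z).
  by apply: cPsi; exact: open_nbhs_nbhs (conj Uo UPsi).
have nk : \forall z \near y, 0 < k z by exact: cvgr_gt ck _ ky.
near=> z; exists (Psi z); first by near: z.
by apply: Psi_K; near: z.
Unshelve. all: by end_near. Qed.

Lemma diffeomorphism_rescale : diffeomorphism U (Phi @` U) Phi.
Proof.
have Vo := open_image_rescale.
split => //.
- move=> i; apply: (@smooth_on_eq _ _ _ (fun x => if i == i_r then
      s (x 0 i_r) else x 0 i)) => //; first by move=> x Ux; rewrite PhiE.
  case: (i == i_r); last exact: smooth_on_coord.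
  by apply: smooth_onM => //; apply: smooth_onV.
- exists Psi; split.
  + move=> i; apply: (@smooth_on_eq _ _ _ (fun y => if i == i_r then
      y 0 i_r / k y else y 0 i)) => //.
    case: (i == i_r); last exact: smooth_on_coord.
    apply: smooth_onM => //; first exact: smooth_on_coord.
    apply: smooth_onV => //; first by move=> y /k_gt0 k0; rewrite gt_eqF.
    apply: smooth_onD => //; first exact: smooth_on_cst.
    apply: smooth_onN => //; apply: smooth_onM => //; first exact: smooth_on_cst.
    exact: smooth_on_coord.
  + by move=> x Ux; split; [exists x|exact: Phi_K].
  + move=> y Vy; case: (Vy) => x Ux xy.
    have UP : U (Psi y) by rewrite -xy Phi_K.
    by split=> //; apply: Psi_K => //; exact: k_gt0.
Qed.

Lemma sds_region y : (Phi @` U) y ->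
  [/\ 0 < y 0 i_r, 0 < sds_profile M lam (y 0 i_r) & sin (y 0 i_th) != 0].
Proof.
move=> [x Ux <-]; rewrite !PhiE//=.
have [r0 _ h0 s0] := U_region Ux.
by split=> //; [exact: divr_gt0|exact: P_gt0].
Qed.

Let partial_Phi i j x : U x ->
  partial i (fun y => Phi y 0 j) x =
  if i == j then (if j == i_r then (h (x 0 i_r) ^+ 2)^-1 else 1) else 0.
Proof.
move=> Ux; rewrite (partial_eq_on _ Uo Ux (fun y Uy => PhiE j Uy)).
have [->|jr] := eqVneq j i_r; last first.
  by rewrite partial_coord; case: eqP.
apply: (partial_coord_derive (F := fun r _ => s r)).
move: i; apply: ord4_ind; rewrite /coord_derive //=.
- exact: s_derive (h_neq0 Ux).
- exact: is_derive_const.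
Qed.

Lemma conformal_static_pullback x : U x ->
  conformal_metric u g x = pullback2 Phi (static_metric (sds_profile M lam)) x.
Proof.
move=> Ux; rewrite conformal_static_warped// /pullback2 static_metric_warped.
(* The Jacobian of [Phi] is diagonal, so the double sum collapses to one term. *)
apply/matrixP => i j; rewrite !mxE (bigD1 i)//= [X in _ + X]big1 => [|l li]; last first.
  by rewrite big1// => m _; rewrite !partial_Phi// eq_sym (negPf li) !mul0r.
rewrite addr0 (bigD1 j)//= big1 => [|l lj]; last first.
  by rewrite !partial_Phi// [j == l]eq_sym (negPf lj) mulr0 mul0r.
rewrite addr0 !partial_Phi// !eqxx mxE !PhiE//=.
case: eqP => [<-|_]; last by rewrite mulr0.
have := (P_neq0 Ux, h_neq0 Ux).
move: i; apply: ord4_ind => /=; rewrite ?mul1r// => -[p0 h0].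
(* Only the rr entry remains: the two Jacobian factors 1 / h^2 account for the h^4 in [B]. *)
by rewrite -/(P _) /b /B; move: (P _) (h _) p0 h0 => p l p0 l0; field; rewrite p0 l0.
Qed.

End SchwarzschildDeSitter.

Theorem mainTheorem16 (R : realType) (M lam c3 : R) (U : set 'rV[R]_4)
  (U_open : open U)
  (U_region : forall x, U x ->
     [/\ 0 < x 0 i_r, 0 < f_profile M lam c3 (x 0 i_r),
         0 < 1 + c3 * x 0 i_r & sin (x 0 i_th) != 0]) :
  let g := static_metric (f_profile M lam c3) in
  let u := u_field c3 in
  let Y := @Y_field R in
  let xi := coord_vector i_t in
  let Phi := rescale_r u in
  let V := Phi @` U in
  [/\ cky_rs_structure U g u Y xi lam,
      closed_2form_on U Y,
      diffeomorphism U V Phi,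
      forall y, V y ->
        [/\ 0 < y 0 i_r, 0 < sds_profile M lam (y 0 i_r) & sin (y 0 i_th) != 0] &
      forall x, U x -> conformal_metric u g x =
        pullback2 Phi (static_metric (sds_profile M lam)) x].
Proof.
split.
- exact: static_cky_rs_structure.
- exact: closed_Y_field.
- exact: (diffeomorphism_rescale U_open U_region).
- exact: (sds_region U_region).
- exact: (conformal_static_pullback U_open U_region).
Qed.
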